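(* Let $K$ be a number field of degree $n\geq3$. Let $M$ and $T$ be the Gram matrices of $M_K^\perp$ and $T_K^\perp$ with respect to a $\mathbf{Z}$-basis of $\mathcal{O}_K^\perp$. Then the shape of $K$ lies on the majorant space of $T_K^\perp$, i.e. $M$ is a positive definite matrix satisfying $MT^{-1}M=T$.
   Context: Let $\sigma_1,\dots,\sigma_n$ be the embeddings $K\to\mathbf{C}$. Define $\alpha^\perp:=n\alpha-\mathrm{Tr}_{K/\mathbf{Q}}(\alpha)$ and $\mathcal{O}_K^\perp=\{\alpha^\perp:\alpha\in\mathcal{O}_K\}$, a free $\mathbf{Z}$-module of rank $n-1$. $M_K^\perp$ is the bilinear form $(u,v)\mapsto\sum_{k=1}^n\sigma_k(u)\overline{\sigma_k(v)}$ on $\mathcal{O}_K^\perp$ (real-valued, positive definite), whose class up to scaling and $\mathrm{GL}_{n-1}(\mathbf{Z})$-equivalence is the shape of $K$; $T_K^\perp$ is the trace form $(u,v)\mapsto\mathrm{Tr}_{K/\mathbf{Q}}(uv)$ on $\mathcal{O}_K^\perp$. The majorant space (Siegel) of a nondegenerate symmetric matrix $T$ is the set of positive definite symmetric matrices $M$ with $MT^{-1}M=T$. *)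

(* Defs.v *)
From HB Require Import structures.
From mathcomp Require Import all_boot all_order all_algebra all_field.
From mathcomp Require Import complex reals.

Set Implicit Arguments.
Unset Strict Implicit.
Unset Printing Implicit Defensive.

Import Order.TTheory GRing.Theory Num.Theory.

Local Open Scope ring_scope.

(* A number field is a K : fieldExtType rat, of degree \dim {:K}; the complex *)
(* numbers are R[i] for R : realType.                                         *)

(* Tr_{K/Q} a is the trace of the Q-linear map x |-> a * x. *)
Definition field_trace (K : fieldExtType rat) (a : K) : rat :=
  \tr (passmx.mxof (vbasis {:K}) (vbasis {:K}) (amull a)).

Definition ring_of_integers (K : fieldExtType rat) (a : K) : Prop :=
  integralOver (intr : int -> K) a.

Definition perp (K : fieldExtType rat) (a : K) : K :=
  a *+ \dim {:K} - (field_trace a)%:A.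

Definition OKperp (K : fieldExtType rat) (u : K) : Prop :=
  exists2 a : K, ring_of_integers a & u = perp a.

Definition is_Zbasis (V : zmodType) (S : V -> Prop) (m : nat)
    (b : 'I_m -> V) : Prop :=
  [/\ forall i, S (b i),
      forall c : 'I_m -> int, \sum_i b i *~ c i = 0 -> forall i, c i = 0
    & forall u, S u -> exists c : 'I_m -> int, u = \sum_i b i *~ c i].

(* sigma lists the field embeddings K -> C, each exactly once. *)
Definition lists_embeddings (R : realType) (K : fieldExtType rat) (n : nat)
    (sigma : 'I_n -> {rmorphism K -> R[i]}) : Prop :=
  (forall j k, sigma j =1 sigma k -> j = k) /\
  (forall f : {rmorphism K -> R[i]}, exists k, f =1 sigma k).

Definition trace_form (K : fieldExtType rat) (u v : K) : rat :=
  field_trace (u * v).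

Definition minkowski_formC (R : realType) (K : fieldExtType rat) (n : nat)
    (sigma : 'I_n -> {rmorphism K -> R[i]}) (u v : K) : R[i] :=
  \sum_k sigma k u * conjc (sigma k v).

(* The real value of minkowski_formC; by minkowski_formE below, no imaginary  *)
(* part is discarded when sigma lists the embeddings of K.                    *)
Definition minkowski_form (R : realType) (K : fieldExtType rat) (n : nat)
    (sigma : 'I_n -> {rmorphism K -> R[i]}) (u v : K) : R :=
  complex.Re (minkowski_formC sigma u v).

Lemma minkowski_formE (R : realType) (K : fieldExtType rat) (n : nat)
    (sigma : 'I_n -> {rmorphism K -> R[i]}) (u v : K) :
  lists_embeddings sigma ->
  real_complex R (minkowski_form sigma u v) = minkowski_formC sigma u v.
Proof.
case=> sigma_inj sigma_surj.
pose cs k : {rmorphism K -> R[i]} := @conjc R \o sigma k.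
have [p csp] : exists p : 'I_n -> 'I_n, forall k, cs k =1 sigma (p k).
  exact: fin_all_exists (fun k => sigma_surj (cs k)).
have p_inj : injective p.
  move=> j k pjk; apply: sigma_inj => x; apply: (inv_inj (@conjcK R)).
  by rewrite -[LHS]/(cs j x) -[RHS]/(cs k x) !csp pjk.
rewrite /minkowski_form ReJ_add.
suff -> : conjc (minkowski_formC sigma u v) = minkowski_formC sigma u v.
  by rewrite -mulr2n -[X in X / _]mulr_natr mulfK // pnatr_eq0.
rewrite /minkowski_formC rmorph_sum [RHS](reindex_inj p_inj) /=.
by apply: eq_bigr => k _; rewrite rmorphM /= -!csp.
Qed.

Definition gram_mx (F V : Type) (m : nat) (B : V -> V -> F)
    (b : 'I_m -> V) : 'M[F]_m :=
  \matrix_(i, j) B (b i) (b j).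

Definition posdefmx (R : realType) (m : nat) (M : 'M[R]_m) : Prop :=
  M^T = M /\ forall x : 'rV[R]_m, x != 0 -> 0 < (x *m M *m x^T) 0 0.

(* Siegel's majorant space is attached to nondegenerate symmetric T only; as  *)
(* invmx T = T for singular T, invertibility must be part of the condition.   *)
Definition majorant_space (R : realType) (m : nat) (T M : 'M[R]_m) : Prop :=
  [/\ T^T = T, T \in unitmx, posdefmx M & M *m invmx T *m M = T].

(* Main.v *)
Require Import Defs.
From HB Require Import structures.
From mathcomp Require Import all_boot all_order all_algebra all_field.
From mathcomp Require Import complex reals.

(** Let [B'] be the square complex matrix whose rows are the images of
    [1, b_1, ..., b_(n-1)] under the embeddings, and [N'] its complex
    conjugate. The vectors [1, b_i] form a [Q]-basis of [K], because the [b_i]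
    are free over [Z] and have trace zero; so [B'] is invertible, by Dedekind's
    independence of characters. As [1] is orthogonal to the [b_i] for both
    forms, [T' := B' B'^T] and [M' := B' N'^T] are block diagonal, with blocks
    [n, T] and [n, M]. Both are real, whence
    [M' T'^-1 M' = (N' B'^T) (B' B'^T)^-1 (B' N'^T) = N' N'^T = T']. *)

Import Order.TTheory GRing.Theory Num.Theory.

Local Open Scope ring_scope.

(** * Independence of the embeddings and the trace formula *)

Lemma dedekind_independence {K : nzRingType} {L : idomainType} {n : nat}
    (sigma : 'I_n -> {rmorphism K -> L}) (v : 'I_n -> L) :
    (forall j k, sigma j =1 sigma k -> j = k) ->
    (forall x, \sum_k v k * sigma k x = 0) ->
  forall k, v k = 0.
Proof.
move=> sigma_inj v0 k.
(* Artin's argument is an induction on the length of the relation, so the index set is generalised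
   to duplicate-free lists. *)
suff indep (r : seq 'I_n) (w : 'I_n -> L) : uniq r ->
    (forall x, \sum_(i <- r) w i * sigma i x = 0) -> {in r, forall i, w i = 0}.
  by apply: (indep (index_enum 'I_n)); rewrite ?index_enum_uniq ?mem_index_enum.
elim: r w => [//|j r IHr] w /= /andP[jNr r_uniq] w0.
have wr0 : {in r, forall i, w i = 0}.
  move=> i ir; apply/eqP/negPn/negP => wi_neq0.
  suff ij : i = j by rewrite -ij ir in jNr.
  apply: sigma_inj => y; apply/eqP; rewrite -subr_eq0.
  suff /eqP : w i * (sigma i y - sigma j y) = 0.
    by rewrite mulf_eq0 (negPf wi_neq0).
  apply: (IHr (fun k => w k * (sigma k y - sigma j y))) => // x.
  (* The relation at [y * x] minus [sigma j y] times the relation at [x] loses the term of [j],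
     which leaves a shorter relation. *)
  have := congr2 (fun a b => a - sigma j y * b) (w0 (y * x)) (w0 x).
  rewrite mulr0 subr0 mulr_sumr -sumrB big_cons rmorphM mulrCA subrr add0r.
  move=> sum0; rewrite -[RHS]sum0; apply: eq_bigr => l _.
  by rewrite rmorphM mulrBr mulrBl mulrA [sigma j y * _]mulrCA mulrA.
move=> i; rewrite inE => /predU1P[->|]; last exact: wr0.
have := w0 1; rewrite big_cons rmorph1 mulr1 big_seq big1 ?addr0 // => l lr.
by rewrite wr0 ?mul0r.
Qed.

Lemma rmorph_ratZ {K : fieldExtType rat} {L : fieldType}
    (f : {rmorphism K -> L}) (q : rat) (x : K) :
  f (q *: x) = ratr q * f x.
Proof. by rewrite -mulr_algl rmorphM alg_num_field fmorph_rat. Qed.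

Definition embed_mx {R : realType} {K : fieldExtType rat} {m n : nat}
    (sigma : 'I_n -> {rmorphism K -> R[i]}) (e : 'I_m -> K) : 'M[R[i]]_(m, n) :=
  \matrix_(i, k) sigma k (e i).

(** A vector killed by the transpose is a linear relation between the embeddings on the basis [e],
    hence by [rat]-linearity on all of [K]; independence makes it zero. *)
Lemma embed_mx_unit {R : realType} {K : fieldExtType rat} {n : nat}
    (sigma : 'I_n -> {rmorphism K -> R[i]}) (e : n.-tuple K) :
  (forall j k, sigma j =1 sigma k -> j = k) -> basis_of {:K} e ->
  embed_mx sigma (fun i => e`_i) \in unitmx.
Proof.
move=> sigma_inj e_basis.
rewrite -unitmx_tr -row_free_unit -kermx_eq0; apply/rowV0P => v /sub_kermxP v0.
apply/rowP => k; rewrite [RHS]mxE; move: k.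
apply: (dedekind_independence sigma) => // x.
rewrite (coord_basis e_basis (memvf x)).
set S := embed_mx _ _ in v0.
transitivity (\sum_i ratr (coord e i x) * (v *m S^T) 0 i).
  under eq_bigr do rewrite rmorph_sum mulr_sumr.
  rewrite exchange_big /=; apply: eq_bigr => i _.
  rewrite mxE mulr_sumr; apply: eq_bigr => k _.
  by rewrite rmorph_ratZ !mxE mulrCA.
by rewrite v0 big1 // => i _; rewrite mxE mulr0.
Qed.

(** The embedding matrix [S] diagonalises multiplication by [a]: the entries of both [A *m S] and
    [S *m D] are the [sigma k (a * e_i)]. The trace is then the sum of the eigenvalues
    [sigma k a]. *)
Lemma field_traceE {R : realType} {K : fieldExtType rat} {n : nat}
    (sigma : 'I_n -> {rmorphism K -> R[i]}) (a : K) :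
  (forall j k, sigma j =1 sigma k -> j = k) -> \dim {:K} = n ->
  ratr (field_trace a) = \sum_k sigma k a.
Proof.
move=> sigma_inj dimK; subst n; rewrite /field_trace.
set e := vbasis {:K}; set A := passmx.mxof e e (amull a).
have e_basis : basis_of {:K} e by exact: vbasisP.
pose S : 'M_(\dim {:K}) := embed_mx sigma (fun i => e`_i).
have S_unit : S \in unitmx by exact: embed_mx_unit.
pose D := diag_mx (\row_k sigma k a).
have AS : map_mx ratr A *m S = S *m D.
  apply/matrixP => i k; rewrite mul_mx_diag !mxE.
  rewrite mulrC -rmorphM -passmx.vecof_delta.
  set y := passmx.vecof e _; have -> : a * y = amull a y by rewrite lfunE.
  rewrite (passmx.hom_vecof _ e_basis) // -/A -rowE rmorph_sum.
  by apply: eq_bigr => j _; rewrite rmorph_ratZ !mxE.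
rewrite -trace_map_mx -[map_mx _ _](mulmxK S_unit) AS mxtrace_mulC mulKmx //.
by rewrite mxtrace_diag; apply: eq_bigr => k _; rewrite mxE.
Qed.

(** * Clearing denominators: from integral to rational freeness *)

Lemma intr_scale_family {m : nat} (c : 'I_m -> rat) :
  exists (d : int) (z : 'I_m -> int),
    d != 0 /\ forall i, d%:~R * c i = (z i)%:~R.
Proof.
exists (\prod_i denq (c i)).
exists (fun i => numq (c i) * \prod_(j | j != i) denq (c j)); split.
  by apply/prodf_neq0 => i _; exact: denq_neq0.
move=> i; rewrite (bigD1 i) //= !intrM numqE.
by rewrite mulrAC [_ * c i]mulrC.
Qed.

Lemma Zfree_Qfree {V : lmodType rat} {m : nat} (b : 'I_m -> V) :
    (forall z : 'I_m -> int, \sum_i b i *~ z i = 0 -> forall i, z i = 0) ->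
  forall c : 'I_m -> rat, \sum_i c i *: b i = 0 -> forall i, c i = 0.
Proof.
move=> b_Zfree c c0 i; have [d [z [d_neq0 dc]]] := intr_scale_family c.
have zi0 : z i = 0.
  apply: b_Zfree; transitivity (d%:~R *: \sum_j c j *: b j).
    rewrite scaler_sumr; apply: eq_bigr => j _.
    by rewrite scalerA dc scaler_int.
  by rewrite c0 scaler0.
have /eqP := dc i; rewrite zi0 mulf_eq0 intr_eq0 (negPf d_neq0) /=.
by move/eqP.
Qed.

(** * The extended basis and its embedding matrix *)

Section EmbeddingsOfNumberField.

Context {R : realType} {K : fieldExtType rat} {m : nat}.
Context (sigma : 'I_m.+1 -> {rmorphism K -> R[i]}) (b : 'I_m -> K).
Context (dimK : \dim {:K} = m.+1) (hsigma : lists_embeddings sigma).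
Context (hb : is_Zbasis (@OKperp K) b).

Lemma sum_embeddings_perp (a : K) : \sum_k sigma k (perp a) = 0.
Proof.
rewrite /perp.
under eq_bigr do rewrite rmorphB rmorphMn rmorph_ratZ rmorph1 mulr1.
rewrite sumrB sumr_const card_ord (field_traceE sigma) ?dimK //.
  by rewrite -sumrMnl subrr.
by case: hsigma.
Qed.

Lemma sum_embeddings_basis i : \sum_k sigma k (b i) = 0.
Proof.
by case: hb => /(_ i) [a _ ->] _ _; exact: sum_embeddings_perp.
Qed.

Let e : m.+1.-tuple K := [tuple of 1 :: [tuple b i | i < m]].

Let e_lift (i : 'I_m) : e`_(lift ord0 i) = b i.
Proof. by rewrite -[RHS](tnth_mktuple b) (tnth_nth 0). Qed.

Lemma cons_one_basis : basis_of {:K} e.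
Proof.
rewrite basisEfree subvf size_tuple dimK leqnn !andbT.
apply/freeP => c; rewrite big_ord_recl /= => ce0.
have sum_ce0 : c ord0 *: 1 + \sum_i c (lift ord0 i) *: b i = 0.
  rewrite -[RHS]ce0; congr (_ + _).
  by apply: eq_bigr => i _; rewrite -e_lift.
(* Summing the relation over all embeddings kills the trace-zero [b i] and leaves [m.+1] times the
   coefficient of [1]. *)
have c0 : c ord0 = 0.
  have : \sum_k sigma k (c ord0 *: 1 + \sum_i c (lift ord0 i) *: b i) = 0.
    by rewrite sum_ce0 big1 // => k _; rewrite rmorph0.
  under eq_bigr do rewrite rmorphD rmorph_ratZ rmorph1 mulr1 rmorph_sum.
  rewrite big_split sumr_const card_ord exchange_big /= [X in _ + X]big1.
    move/eqP; rewrite addr0 -mulr_natr mulf_eq0 pnatr_eq0 orbF fmorph_eq0.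
    by move/eqP.
  move=> i _; under eq_bigr do rewrite rmorph_ratZ.
  by rewrite -mulr_sumr sum_embeddings_basis mulr0.
case: hb => _ /Zfree_Qfree b_free _.
move: sum_ce0; rewrite c0 scale0r add0r => /b_free cl0 i.
by case: (unliftP ord0 i) => [j|] ->.
Qed.

Let B : 'M[R[i]]_(m, m.+1) := embed_mx sigma b.
(** The size is written [1 + m], convertible to [m.+1], so that block operations apply to a square
    matrix. *)
Let B' : 'M[R[i]]_(1 + m) := col_mx (const_mx 1 : 'M_(1, 1 + m)) B.
Let N := map_mx (@conjc R) B.
Let N' := map_mx (@conjc R) B'.

Let B'_unit : B' \in unitmx.
Proof.
suff -> : B' = embed_mx sigma (fun i => e`_i).
  by apply: embed_mx_unit; [case: hsigma | exact: cons_one_basis].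
apply/matrixP => i k; case: (split_ordP i) => j ->.
  by rewrite col_mxEu !mxE (ord1 j) /= rmorph1.
by rewrite col_mxEd !mxE -e_lift; congr (sigma k e`_ _).
Qed.

(** * Gram matrices as products of embedding matrices *)

Local Notation toC := (map_mx (real_complex R)).
Let M := gram_mx (minkowski_form sigma) b.
Let T : 'M[R]_m := map_mx ratr (gram_mx (@trace_form K) b).

Let toC_T : toC T = B *m B^T.
Proof.
apply/matrixP => i j; rewrite !mxE fmorph_rat /trace_form.
rewrite (field_traceE sigma) //; last by case: hsigma.
by apply: eq_bigr => k _; rewrite !mxE rmorphM.
Qed.

Let toC_M : toC M = B *m N^T.
Proof.
apply/matrixP => i j; rewrite !mxE minkowski_formE //.
by apply: eq_bigr => k _; rewrite !mxE.
Qed.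

Let conj_toC {p q : nat} (A : 'M[R]_(p, q)) : map_mx (@conjc R) (toC A) = toC A.
Proof. by apply/matrixP => i j; rewrite !mxE conjc_real. Qed.

(** As [M] is real, conjugating [B *m N^T] does not change it. *)
Let toC_M_conj : toC M = N *m B^T.
Proof.
rewrite -conj_toC toC_M map_mxM -map_trmx; congr (_ *m _^T).
by apply/matrixP => i j; rewrite !mxE /= conjcK.
Qed.

(** * Splitting off the line spanned by [1] *)

Let u : 'M[R[i]]_(1, 1 + m) := const_mx 1.

Let u_unit : u *m u^T \in unitmx.
Proof.
rewrite unitmxE det_mx11 unitfE mxE.
under eq_bigr do rewrite !mxE mulr1.
by rewrite sumr_const card_ord pnatr_eq0.
Qed.

(** The entries are the traces of the [b j]: this is the orthogonality of [1] to the lattice. *)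
Let uB : u *m B^T = 0.
Proof.
apply/matrixP => i j; rewrite !mxE -[RHS](sum_embeddings_basis j).
by apply: eq_bigr => k _; rewrite !mxE mul1r.
Qed.

Let conj_u : map_mx (@conjc R) u = u.
Proof. by apply/matrixP => i j; rewrite !mxE conjc1. Qed.

Let uN : u *m N^T = 0.
Proof. by rewrite -conj_u map_trmx -map_mxM uB map_mx0. Qed.

Let Bu : B *m u^T = 0.
Proof. by apply: trmx_inj; rewrite trmx_mul trmxK uB trmx0. Qed.

Let Nu : N *m u^T = 0.
Proof. by apply: trmx_inj; rewrite trmx_mul trmxK uN trmx0. Qed.

Let N'E : N' = col_mx u N.
Proof. by rewrite /N' map_col_mx conj_u. Qed.

Let B'B' : B' *m B'^T = block_mx (u *m u^T) 0 0 (toC T).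
Proof. by rewrite toC_T tr_col_mx mul_col_row uB Bu. Qed.

Let B'N' : B' *m N'^T = block_mx (u *m u^T) 0 0 (toC M).
Proof. by rewrite toC_M N'E tr_col_mx mul_col_row uN Bu. Qed.

Let N'B' : N' *m B'^T = block_mx (u *m u^T) 0 0 (toC M).
Proof. by rewrite toC_M_conj N'E tr_col_mx mul_col_row uB Nu. Qed.

Let N'N' : N' *m N'^T = block_mx (u *m u^T) 0 0 (toC T).
Proof.
rewrite map_trmx -map_mxM B'B' map_block_mx conj_toC !map_mx0 map_mxM.
by rewrite -map_trmx conj_u.
Qed.

(** * Nondegeneracy, the majorant equation and positivity *)

Let B'B'_unit : B' *m B'^T \in unitmx.
Proof. by rewrite unitmx_mul unitmx_tr B'_unit. Qed.

Let T_unit : T \in unitmx.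
Proof.
(* The determinant of the block matrix is that of [u *m u^T] times that of [toC T], so both factors
   are units. *)
move: B'B'_unit; rewrite B'B' unitmxE det_ublock unitrM => /andP[_].
by rewrite -unitmxE map_unitmx.
Qed.

Let majorant_eq : M *m invmx T *m M = T.
Proof.
apply: (map_mx_inj (f := real_complex R)); rewrite !map_mxM map_invmx.
have toCT_unit : toC T \in unitmx by rewrite map_unitmx.
have inv_block : invmx (B' *m B'^T)
    = block_mx (invmx (u *m u^T)) 0 0 (invmx (toC T)).
  rewrite -[RHS](mulKmx B'B'_unit) [X in _ *m (X *m _)]B'B' mulmx_block.
  by rewrite !mulmx0 !mul0mx !addr0 !add0r !mulmxV // -scalar_mx_block mulmx1.
have : (N' *m B'^T) *m invmx (B' *m B'^T) *m (B' *m N'^T) = N' *m N'^T.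
  have -> : N' *m B'^T = N' *m invmx B' *m (B' *m B'^T).
    by rewrite mulmxA mulmxKV.
  by rewrite mulmxK // mulmxA mulmxKV.
rewrite N'B' B'N' N'N' inv_block !mulmx_block.
rewrite !(mulmx0, mul0mx, addr0, add0r).
(* The lower right blocks give the equation for [M] and [T]. *)
by case/eq_block_mx.
Qed.

(** With [y] the row [x *m B], the form at [x] is the sum of the [|y_k|^2]. *)
Let M_posdef : posdefmx M.
Proof.
split.
  apply: (map_mx_inj (f := real_complex R)).
  by rewrite -map_trmx {1}toC_M_conj trmx_mul trmxK toC_M.
move=> x x_neq0; pose y := toC x *m B.
have y_neq0 : y != 0.
  apply: contraNneq x_neq0 => y0.
  (* Padding [x] with a zero brings in the invertible [B'], so the rows of [B] are independent. *)
  have : row_mx 0 (toC x) *m B' = 0 by rewrite mul_row_col mul0mx add0r.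
  move/(congr1 (mulmx^~ (invmx B'))); rewrite mulmxK // mul0mx -row_mx0.
  by case/eq_row_mx => _ /eqP; rewrite map_mx_eq0.
have toC_xMx : real_complex R ((x *m M *m x^T) 0 0) = \sum_k `|y 0 k| ^+ 2.
  transitivity ((toC (x *m M *m x^T)) 0 0); first by rewrite [RHS]mxE.
  rewrite !map_mxM toC_M -map_trmx -!mulmxA mulmxA -/y.
  rewrite -[N^T *m _]trmxK trmx_mul trmxK trmxK mxE.
  apply: eq_bigr => k _; rewrite normCK; congr (_ * _).
  (* Since [x] is real, [toC x *m N] is the conjugate of [y]. *)
  by rewrite mxE -[toC x]conj_toC -map_mxM mxE.
rewrite -ltcR toC_xMx lt0r sumr_ge0 ?andbT => [|k _]; last exact: exprn_ge0.
apply: contra_neq y_neq0 => /psumr_eq0P sum0.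
apply/rowP => k; rewrite [RHS]mxE; apply/eqP.
by rewrite -normr_eq0 -sqrf_eq0 sum0 // => l _; exact: exprn_ge0.
Qed.

Lemma minkowski_gram_majorant : majorant_space T M.
Proof.
split=> //.
apply: (map_mx_inj (f := real_complex R)).
by rewrite -map_trmx toC_T trmx_mul trmxK.
Qed.

End EmbeddingsOfNumberField.

Theorem theoremC (R : realType) (K : fieldExtType rat) (n : nat)
    (hn : (3 <= n)%N) (hK : \dim {:K} = n)
    (sigma : 'I_n -> {rmorphism K -> R[i]}) (hsigma : lists_embeddings sigma)
    (b : 'I_n.-1 -> K) (hb : is_Zbasis (@OKperp K) b)
    (M : 'M[R]_n.-1) (hM : M = gram_mx (minkowski_form sigma) b)
    (T : 'M[rat]_n.-1) (hT : T = gram_mx (@trace_form K) b) :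
  majorant_space (map_mx ratr T) M.
Proof.
(* Writing [n] as [m.+1] turns [n.-1] into [m]; [n = 0] contradicts [hn]. *)
case: n hn hK sigma hsigma b hb M hM T hT => // m _ dimK sigma.
move=> hsigma b hb M -> T ->.
exact: minkowski_gram_majorant.
Qed.
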